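(* Any $m\times n$ matrix $A$ of rank $r$ over a field has a $VPU$ decomposition $A=VPU$, where $V$ ($m\times m$) and $U$ ($n\times n$) are upper triangular matrices and $P$ is an $m\times n$ $r$-sub-permutation matrix.
   Context: An $r$-sub-permutation matrix is a matrix of rank $r$ with only $r$ nonzero entries, all equal to one (hence at most one nonzero entry per row and per column). $V$ and $U$ are not required to be invertible. *)

(* Defs.v *)
From mathcomp Require Import all_boot all_algebra.

Set Implicit Arguments.
Unset Strict Implicit.
Unset Printing Implicit Defensive.

Import GRing.Theory.
Local Open Scope ring_scope.

(* The library's is_trig_mx means lower triangular. *)
Definition is_upper_trig_mx (R : nmodType) (m n : nat) (A : 'M[R]_(m, n)) : bool :=
  is_trig_mx A^T.

Definition is_sub_perm_mx (F : fieldType) (m n r : nat) (P : 'M[F]_(m, n)) : bool :=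
  [&& \rank P == r,
      #|[set ij : 'I_m * 'I_n | P ij.1 ij.2 != 0]| == r
    & [forall i, forall j, (P i j != 0) ==> (P i j == 1)]].

(* Main.v *)
(** Induction on the number of rows.  If the rows below the first one decompose
as [V P U], write the first row as [w U].  Adding multiples of the lower rows
to the first one is an upper triangular operation, and clears the entries of
[w] in the pivot columns of [P].  If the remainder [w'] is nonzero, with leftmost
nonzero entry in column [j], it is [e_j U1] where [U1] is the identity matrix
with row [j] replaced by [w']; [U1] is upper triangular, and [P U1 = P] since
column [j] of [P] is zero, so [e_j] can be put on top of [P].  [V] and [U] stay
invertible throughout, whence the rank of [P]. *)

Require Import Defs.
From mathcomp Require Import all_boot all_algebra.

Set Implicit Arguments.
Unset Strict Implicit.
Unset Printing Implicit Defensive.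

Import GRing.Theory.
Local Open Scope ring_scope.

Lemma is_upper_trig_mxP (R : nmodType) (m n : nat) (A : 'M[R]_(m, n)) :
  reflect (forall (i : 'I_m) (j : 'I_n), (j < i)%N -> A i j = 0) (is_upper_trig_mx A).
Proof.
apply: (iffP is_trig_mxP) => [tA i j ji | tA i j ij].
  by have := tA j i ji; rewrite mxE.
by rewrite mxE tA.
Qed.

Lemma is_upper_trig_mxM (R : pzRingType) (n : nat) (A B : 'M[R]_n) :
  is_upper_trig_mx A -> is_upper_trig_mx B -> is_upper_trig_mx (A *m B).
Proof.
move=> /is_upper_trig_mxP tA /is_upper_trig_mxP tB; apply/is_upper_trig_mxP.
move=> i j ji; rewrite mxE big1 // => k _.
case: (ltnP k i) => [ki | ik]; first by rewrite tA ?mul0r.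
by rewrite tB ?mulr0 // (leq_trans ji).
Qed.

Lemma is_upper_trig_mx_ublock (R : pzRingType) (m : nat) (a : 'M[R]_1)
    (c : 'rV[R]_m) (V : 'M[R]_m) :
  is_upper_trig_mx V -> is_upper_trig_mx (block_mx a c 0 V).
Proof.
move=> tV; rewrite /is_upper_trig_mx tr_block_mx trmx0.
by rewrite is_trig_block_mx // eqxx mx11_is_trig.
Qed.

Lemma unitmx_upper_trig (F : fieldType) (n : nat) (A : 'M[F]_n) :
  is_upper_trig_mx A -> (forall i, A i i != 0) -> A \in unitmx.
Proof.
move=> tA nzA; rewrite unitmxE -det_tr (det_trig tA) unitfE.
by apply/prodf_neq0 => i _; rewrite mxE.
Qed.

Lemma delta_mx_upper_trig_unit (F : fieldType) (n : nat) (w : 'rV[F]_n) :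
  w != 0 -> exists (j : 'I_n) (U : 'M[F]_n),
  [/\ w 0 j != 0, is_upper_trig_mx U, U \in unitmx, delta_mx 0 j *m U = w
    & forall m (P : 'M[F]_(m, n)), col j P = 0 -> P *m U = P].
Proof.
case/rV0Pn => j0 nz0.
case: (@arg_minnP _ j0 (fun j => w 0 j != 0) (@nat_of_ord n) nz0) => j nzj minj.
(* A rank-one update of the identity: row [j] becomes [w], all other rows stay. *)
pose U : 'M[F]_n := 1%:M + delta_mx j 0 *m (w - delta_mx 0 j).
have UE i k : U i k = (i == k)%:R + (i == j)%:R * (w 0 k - (k == j)%:R).
  by rewrite !mxE big_ord1 !mxE eqxx andbT.
have tU : is_upper_trig_mx U.
  apply/is_upper_trig_mxP => i k ki; rewrite UE.
  have /negPf-> : i != k by rewrite neq_ltn ki orbT.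
  case: (eqVneq i j) => [ij | _]; last by rewrite mul0r addr0.
  rewrite ij in ki.
  have /negPf-> : k != j by rewrite neq_ltn ki.
  (* The entry is now [w 0 k] with [k < j], zero by the minimality of [j]. *)
  rewrite subr0 add0r mul1r; apply/eqP/negPn/negP => /minj.
  by rewrite leqNgt ki.
exists j, U; split=> //.
- apply: unitmx_upper_trig => // i; rewrite UE eqxx.
  case: (eqVneq i j) => [-> | _]; last by rewrite mul0r addr0 oner_eq0.
  by rewrite mul1r addrC subrK.
- rewrite mulmxDr mulmx1 mulmxA mul_delta_mx.
  have -> : delta_mx 0 0 = 1%:M :> 'M[F]_1.
    by apply/matrixP => i k; rewrite !ord1 !mxE.
  by rewrite mul1mx addrC subrK.
- by move=> m P Pj; rewrite mulmxDr mulmx1 mulmxA -colE Pj mul0mx addr0.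
Qed.

(** Right multiplication by [e^T] kills the row space of [P] and sends [c *m e] to [c], so the line
    spanned by [e] meets that row space only in 0. *)
Lemma mxrank_col_mx_orthogonal (F : fieldType) (m n : nat) (e : 'rV[F]_n)
    (P : 'M[F]_(m, n)) :
  e *m e^T = 1%:M -> P *m e^T = 0 -> \rank (col_mx e P) = (\rank P).+1.
Proof.
move=> ee Pe; rewrite -addsmxE mxrank_disjoint_sum; last first.
  apply/eqP; rewrite -submx0; apply/rV_subP => v.
  rewrite sub_capmx => /andP[/submxP[c vc] /submxP[D vD]].
  have c0 : c = 0.
    by rewrite -[c]mulmx1 -ee mulmxA -vc vD -mulmxA Pe mulmx0.
  by rewrite vc c0 mul0mx sub0mx.
rewrite rank_rV; case: eqP => // e0.
move: ee; rewrite e0 mul0mx => /matrixP/(_ 0 0)/eqP.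
by rewrite !mxE eq_sym oner_eq0.
Qed.

(* Given that each row is zero or a unit vector, [P P^T P = P] forbids two ones
   in a column; it also makes [w P^T] the coefficients that clear the pivot
   columns of a row [w]. *)
Definition partial_perm_mx (F : fieldType) (m n : nat) (P : 'M[F]_(m, n)) :=
  [/\ forall i, row i P = 0 \/ exists j, row i P = delta_mx 0 j,
      P *m P^T *m P = P
    & (\sum_i \sum_j (P i j != 0%R))%N = \rank P].

Lemma partial_perm_col_mx0 (F : fieldType) (m n : nat) (P : 'M[F]_(m, n)) :
  partial_perm_mx P -> partial_perm_mx (col_mx (0 : 'rV_n) P).
Proof.
case=> rP PPP cP; split.
- move=> i; case: (split_ordP i) => k ->.
    by left; rewrite rowKu row0.
  by rewrite rowKd.
- by rewrite tr_col_mx trmx0 mul_col_row !mul0mx !mulmx0 mul_block_col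
     !mul0mx !add0r PPP.
- rewrite -addsmxE adds0mx -cP big_split_ord /= big_ord1 big1 ?add0n.
    by apply: eq_bigr => i _; apply: eq_bigr => j _; rewrite col_mxEd.
  by move=> j _; rewrite col_mxEu mxE eqxx.
Qed.

(** A zero column [j] makes the new row orthogonal to every row of [P]. The off-diagonal blocks of
    the Gram matrix vanish, and the identity on [P *m P^T *m P] splits into blocks. *)
Lemma partial_perm_col_mx_delta (F : fieldType) (m n : nat)
    (P : 'M[F]_(m, n)) (j : 'I_n) :
  partial_perm_mx P -> col j P = 0 ->
  partial_perm_mx (col_mx (delta_mx 0 j : 'rV_n) P).
Proof.
move=> [rP PPP cP] Pj.
have ee : delta_mx 0 j *m (delta_mx 0 j)^T = 1%:M :> 'M[F]_1.
  rewrite trmx_delta mul_delta_mx.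
  by apply/matrixP => i k; rewrite !ord1 !mxE.
have Pe : P *m (delta_mx 0 j : 'rV_n)^T = 0 by rewrite trmx_delta -colE.
have eP : delta_mx 0 j *m P^T = 0 :> 'rV_m.
  by apply: trmx_inj; rewrite trmx_mul trmxK Pe trmx0.
split.
- move=> i; case: (split_ordP i) => k ->.
    by right; exists j; rewrite rowKu; apply/rowP => l; rewrite !mxE !ord1.
  by rewrite rowKd.
- by rewrite tr_col_mx mul_col_row mul_block_col ee Pe eP mul1mx !mul0mx
     addr0 add0r PPP.
- rewrite mxrank_col_mx_orthogonal // -cP big_split_ord /= big_ord1.
  rewrite -[in RHS]add1n.
  congr (_ + _)%N.
    rewrite (bigD1 j) //= col_mxEu mxE !eqxx oner_eq0 big1 // => k kj.
    by rewrite col_mxEu mxE (negPf kj) eqxx.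
  by apply: eq_bigr => i _; apply: eq_bigr => k _; rewrite col_mxEd.
Qed.

(** Invertibility is part of the induction: the inverse of [U] expresses the new top row as
    [w *m U]. *)
Lemma VPU_decomposition (F : fieldType) (m n : nat) (A : 'M[F]_(m, n)) :
  exists (V : 'M[F]_m) (P : 'M[F]_(m, n)) (U : 'M[F]_n),
    [/\ is_upper_trig_mx V /\ V \in unitmx, is_upper_trig_mx U /\ U \in unitmx,
        partial_perm_mx P & A = V *m P *m U].
Proof.
elim: m A => [|m IH] A.
  exists 1%:M, A, 1%:M; rewrite mul1mx mulmx1 !unitmx1 /is_upper_trig_mx.
  rewrite !trmx1 !scalar_mx_is_trig; split=> //; split=> [[]//||].
    by rewrite [A]flatmx0 mulmx0.
  by rewrite big_ord0 [A]flatmx0 mxrank0.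
rewrite -[m.+1]/(1 + m)%N in A *.
have [V [P [U [[tV uV] [tU uU] PP defA]]]] := IH (dsubmx A).
have [rP PPP _] := PP.
pose w := usubmx A *m invmx U.
pose c := w *m P^T.
pose w' := w - c *m P.
have tV' : is_upper_trig_mx (block_mx 1%:M c 0 V).
  exact: is_upper_trig_mx_ublock.
have uV' : block_mx 1%:M c 0 V \in unitmx.
  by rewrite unitmxE det_ublock det1 mul1r -unitmxE.
have A_eq : A = block_mx 1%:M c 0 V *m col_mx w' P *m U.
  rewrite mul_block_col mul1mx subrK mul0mx add0r mul_col_mx -defA.
  by rewrite mulmxKV // vsubmxK.
have [w'0 | nzw'] := eqVneq w' 0.
  exists (block_mx 1%:M c 0 V), (col_mx 0 P), U; split=> //.
    exact: partial_perm_col_mx0.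
  by rewrite -w'0.
have [j [U1 [nzj tU1 uU1 eU1 PU1]]] := delta_mx_upper_trig_unit nzw'.
(* By the choice of [c], this product is [w *m P^T - w *m P^T *m P *m P^T]. *)
have w'P : w' *m P^T = 0.
  have PTPPT : P^T *m P *m P^T = P^T.
    by apply: trmx_inj; rewrite !trmx_mul !trmxK mulmxA PPP.
  by rewrite mulmxBl /c -!mulmxA (mulmxA P^T) PTPPT subrr.
clearbody w'.
(* If [P i j] were nonzero, row [i] of [P] would be the unit vector at [j], and entry [i] of
   [w' *m P^T] would be [w' 0 j], which is nonzero. *)
have Pj : col j P = 0.
  apply/colP => i; rewrite !mxE.
  have Pij k : P i k = row i P 0 k by rewrite mxE.
  case: (rP i) => [r0 | [k rk]]; first by rewrite Pij r0 mxE.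
  rewrite Pij rk mxE /=; case: eqVneq => // jk.
  move/rowP/(_ i): w'P; rewrite !mxE (bigD1 j) //= big1 => [|l lj].
    by rewrite mxE Pij rk mxE jk !eqxx mulr1 addr0 -jk => /eqP/(negP nzj).
  by rewrite mxE Pij rk mxE -jk (negPf lj) mulr0.
(* Since [U1] fixes [P] and sends the unit vector to [w'], it is absorbed into the right factor
   alone. *)
exists (block_mx 1%:M c 0 V), (col_mx (delta_mx 0 j) P), (U1 *m U); split=> //.
- by rewrite unitmx_mul uU1 uU is_upper_trig_mxM.
- exact: partial_perm_col_mx_delta.
- by rewrite mulmxA -(mulmxA (block_mx _ _ _ _)) mul_col_mx eU1 PU1.
Qed.

Lemma partial_perm_sub_perm (F : fieldType) (m n : nat) (P : 'M[F]_(m, n)) :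
  partial_perm_mx P -> is_sub_perm_mx (\rank P) P.
Proof.
case=> rP _ cP; apply/and3P; split=> //.
  rewrite -{}cP pair_big -sum1_card big_mkcond /=; apply/eqP/eq_bigr => ij _.
  by rewrite inE; case: (_ != 0).
apply/forallP => i; apply/forallP => j; apply/implyP.
have -> : P i j = row i P 0 j by rewrite mxE.
case: (rP i) => [-> | [k ->]]; rewrite mxE ?eqxx //=.
by case: (j == k); rewrite ?eqxx.
Qed.

Theorem corollary25 (F : fieldType) (m n r : nat) (A : 'M[F]_(m, n))
    (rankA : \rank A = r) :
  exists (V : 'M[F]_m) (P : 'M[F]_(m, n)) (U : 'M[F]_n),
    [/\ is_upper_trig_mx V, is_upper_trig_mx U, is_sub_perm_mx r P
      & A = V *m P *m U].
Proof.
have [V [P [U [[tV uV] [tU uU] PP defA]]]] := VPU_decomposition A.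
exists V, P, U; split=> //.
suff <- : \rank P = r by exact: partial_perm_sub_perm.
rewrite -rankA defA mxrankMfree ?row_free_unit //.
(* Transposing moves [V] to the right, where an invertible factor preserves rank. *)
rewrite -[RHS]mxrank_tr trmx_mul mxrankMfree ?mxrank_tr //.
by rewrite row_free_unit unitmx_tr.
Qed.
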